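(* A cograph $G$ is a Maya-Tupi graph if and only if it is $\mathcal{F}_{cog}$-free.
   Context: All graphs are finite and simple. A graph $G$ is Maya-Tupi if its vertex set can be partitioned into two (possibly empty) sets $A$ and $B$ such that $\delta(G[A])\ge |A|-2$ and $\Delta(G[B])\le 1$. A cograph is a graph with no induced path on four vertices. A graph is $\mathcal{F}$-free if it has no induced subgraph isomorphic to a member of $\mathcal{F}$. $G+H$ denotes disjoint union and $pG$ the disjoint union of $p$ copies of $G$; the diamond is $K_4$ minus an edge. $\mathcal{F}_{cog}$ is the family consisting of the graphs $3P_3$, $2P_3+K_3$, $P_3+2K_3$, $3K_3$, $C_4+J$, $\mathrm{diamond}+J$ and $K_4+J$ for $J\in\{P_3,K_3\}$, together with the complements of all these graphs. *)

(* Defs.v *)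
From mathcomp Require Import all_boot.

Set Implicit Arguments.
Unset Strict Implicit.
Unset Printing Implicit Defensive.

Record sgraph := SGraph {
  vertex :> finType;
  edge : rel vertex;
  edge_sym : symmetric edge;
  edge_irrefl : irreflexive edge }.

Definition isomorphic (G H : sgraph) : Prop :=
  exists2 f : G -> H, bijective f & {mono f : x y / edge x y}.

Section Constructions.
Variables (G H : sgraph).

Definition induced_edge (S : {set G}) : rel {x : G | x \in S} :=
  fun x y => edge (val x) (val y).
Lemma induced_sym S : symmetric (@induced_edge S).
Proof. by move=> x y; apply: edge_sym. Qed.
Lemma induced_irrefl S : irreflexive (@induced_edge S).
Proof. by move=> x; apply: edge_irrefl. Qed.
Definition induced (S : {set G}) : sgraph :=
  SGraph (@induced_sym S) (@induced_irrefl S).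

Definition compl_edge : rel G := fun x y => (x != y) && ~~ edge x y.
Lemma compl_sym : symmetric compl_edge.
Proof. by move=> x y; rewrite /compl_edge eq_sym edge_sym. Qed.
Lemma compl_irrefl : irreflexive compl_edge.
Proof. by move=> x; rewrite /compl_edge eqxx. Qed.
Definition compl : sgraph := SGraph compl_sym compl_irrefl.

Definition disjoint_union_edge : rel (G + H)%type := fun u v =>
  match u, v with
  | inl x, inl y => edge x y
  | inr x, inr y => edge x y
  | _, _ => false
  end.
Lemma disjoint_union_sym : symmetric disjoint_union_edge.
Proof. by case=> x [] y //=; apply: edge_sym. Qed.
Lemma disjoint_union_irrefl : irreflexive disjoint_union_edge.
Proof. by case=> x /=; apply: edge_irrefl. Qed.
Definition disjoint_union : sgraph :=
  SGraph disjoint_union_sym disjoint_union_irrefl.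

Definition copies_edge (p : nat) : rel ('I_p * G)%type :=
  fun u v => (u.1 == v.1) && edge u.2 v.2.
Lemma copies_sym p : symmetric (@copies_edge p).
Proof. by move=> u v; rewrite /copies_edge eq_sym edge_sym. Qed.
Lemma copies_irrefl p : irreflexive (@copies_edge p).
Proof. by move=> u; rewrite /copies_edge edge_irrefl andbF. Qed.
Definition copies (p : nat) : sgraph := SGraph (@copies_sym p) (@copies_irrefl p).

Definition delete_edge_rel (a b : G) : rel G :=
  fun x y => edge x y && ([set x; y] != [set a; b]).
Lemma delete_edge_sym a b : symmetric (delete_edge_rel a b).
Proof. by move=> x y; rewrite /delete_edge_rel edge_sym setUC. Qed.
Lemma delete_edge_irrefl a b : irreflexive (delete_edge_rel a b).
Proof. by move=> x; rewrite /delete_edge_rel edge_irrefl. Qed.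
Definition delete_edge (a b : G) : sgraph :=
  SGraph (delete_edge_sym a b) (delete_edge_irrefl a b).

End Constructions.

Section NamedGraphs.
Variable n : nat.

Definition complete_edge : rel 'I_n := fun x y => x != y.
Lemma complete_sym : symmetric complete_edge.
Proof. by move=> x y; rewrite /complete_edge eq_sym. Qed.
Lemma complete_irrefl : irreflexive complete_edge.
Proof. by move=> x; rewrite /complete_edge eqxx. Qed.
Definition K_ : sgraph := SGraph complete_sym complete_irrefl.

Definition path_edge : rel 'I_n :=
  fun x y => (x.+1 == y :> nat) || (y.+1 == x :> nat).
Lemma path_sym : symmetric path_edge.
Proof. by move=> x y; rewrite /path_edge orbC. Qed.
Lemma path_irrefl : irreflexive path_edge.
Proof. by move=> x; rewrite /path_edge orbb gtn_eqF. Qed.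
(* The path on n vertices. *)
Definition P_ : sgraph := SGraph path_sym path_irrefl.

(* ordS is the successor modulo n; the clause x != y only matters for n = 1. *)
Definition cycle_edge : rel 'I_n :=
  fun x y => (x != y) && ((ordS x == y) || (ordS y == x)).
Lemma cycle_sym : symmetric cycle_edge.
Proof. by move=> x y; rewrite /cycle_edge eq_sym orbC. Qed.
Lemma cycle_irrefl : irreflexive cycle_edge.
Proof. by move=> x; rewrite /cycle_edge eqxx. Qed.
Definition C_ : sgraph := SGraph cycle_sym cycle_irrefl.

End NamedGraphs.

Definition diamond : sgraph :=
  @delete_edge (K_ 4) (inord 0 : 'I_4) (inord 1 : 'I_4).

Definition degree (G : sgraph) (x : G) : nat := #|[set y | edge x y]|.

(* Degrees are smaller than #|G|, so the default value #|G| is only relevant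
   for the graph without vertices, whose minimum degree is thus 0. *)
Definition min_degree (G : sgraph) : nat :=
  \big[minn/#|G|]_(x : G) degree x.

Definition max_degree (G : sgraph) : nat := \max_(x : G) degree x.

(* The bound on the minimum degree is written additively because subtraction
   on nat is truncated. *)
Definition maya_tupi (G : sgraph) : Prop :=
  exists A B : {set G},
    [/\ A :|: B = [set: G], A :&: B = set0,
        #|A| <= min_degree (induced A) + 2
      & max_degree (induced B) <= 1].

Definition is_free (F : sgraph -> Prop) (G : sgraph) : Prop :=
  forall H : sgraph, F H -> ~ exists S : {set G}, isomorphic (induced S) H.

Definition cograph (G : sgraph) : Prop := is_free (fun H => H = P_ 4) G.

Inductive F_cog_base : sgraph -> Prop :=
| F_3P3 : F_cog_base (copies (P_ 3) 3)
| F_2P3_K3 : F_cog_base (disjoint_union (copies (P_ 3) 2) (K_ 3))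
| F_P3_2K3 : F_cog_base (disjoint_union (P_ 3) (copies (K_ 3) 2))
| F_3K3 : F_cog_base (copies (K_ 3) 3)
| F_C4_J J : J = P_ 3 \/ J = K_ 3 -> F_cog_base (disjoint_union (C_ 4) J)
| F_diamond_J J : J = P_ 3 \/ J = K_ 3 -> F_cog_base (disjoint_union diamond J)
| F_K4_J J : J = P_ 3 \/ J = K_ 3 -> F_cog_base (disjoint_union (K_ 4) J).

Inductive F_cog : sgraph -> Prop :=
| F_cog_self H : F_cog_base H -> F_cog H
| F_cog_compl H : F_cog_base H -> F_cog (compl H).

(* Main.v *)
(* A Maya-Tupi partition is a pair (A, B) where no vertex of A has two
   non-neighbours in A and no vertex of B has two neighbours in B. Call a vertex
   with two neighbours a cherry (P_3 or K_3), and a 4-cycle that need not be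
   induced a square (C_4, diamond or K_4): the members of F_cog are three
   mutually non-adjacent cherries, or a square and a cherry that are
   non-adjacent, up to complement.

   Conversely, by induction on the number of vertices and up to complement, G is
   the disjoint union of X and Y. If X has no cherry, it is added to the B-part
   of Y. If both have cherries, neither has a square nor two non-adjacent
   cherries, so that one vertex of each meets all its cherries; these two
   vertices form A. *)

From Corelib Require Import Setoid.
Require Import Defs.
From mathcomp Require Import all_boot.

Set Implicit Arguments.
Unset Strict Implicit.
Unset Printing Implicit Defensive.

(** * Cherries, squares and separations for a pair of complementary relations *)

Section Complementary.
Variable T : finType.
Implicit Types (e c : rel T) (S X Y D A B : {set T}).

(* The two relations play the roles of adjacency and non-adjacency, so that
   complementing the graph is just exchanging them. *)
Definition complementary e c :=
  [/\ symmetric e, irreflexive e & forall x y, c x y = (x != y) && ~~ e x y].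

Lemma complementaryC e c : complementary e c -> complementary c e.
Proof.
case=> e_sym e_irr cE; split=> [x y|x|x y]; rewrite !cE.
- by rewrite eq_sym e_sym.
- by rewrite eqxx.
- by rewrite negb_and !negbK; case: eqVneq => //= ->; rewrite e_irr.
Qed.

Definition cherry e D := exists x y z,
  [/\ x \in D, y \in D, z \in D & [/\ y != z, e x y & e x z]].

Definition square e D := exists x y z t,
  [/\ x \in D, y \in D, z \in D, t \in D
    & [/\ x != z, y != t & [/\ e x y, e y z, e z t & e t x]]].

Definition complete_to c X Y := {in X & Y, forall x y, c x y}.

(** For complementary relations, which are irreflexive, the six conditions also make the four
    vertices distinct. *)
Definition p4_free e c := forall x y z t,
  ~ [/\ e x y, e y z, e z t & [/\ c x z, c y t & c x t]].

(** The sets are hosts of the cherries and squares, not their exact vertex sets, so that a whole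
    side of a separation can serve as one. *)
Definition obstructed e c :=
  (exists D1 D2 D3, [/\ cherry e D1, cherry e D2, cherry e D3
     & [/\ complete_to c D1 D2, complete_to c D1 D3 & complete_to c D2 D3]])
  \/ (exists D1 D2, [/\ square e D1, cherry e D2 & complete_to c D1 D2]).

(** A Maya-Tupi partition of the subgraph on [S]. Keeping the ambient type lets the induction run
    over subsets. *)
Definition split_set e c S := exists A B,
  [/\ A :|: B = S, A :&: B = set0, ~ cherry c A & ~ cherry e B].

(** With non-adjacency as [c] this says that the graph on [S] is disconnected; with adjacency, that
    its complement is. *)
Definition separated c S := exists X Y,
  [/\ X :|: Y = S, X != set0, Y != set0 & complete_to c X Y].

Lemma setUDK A B : A \subset B -> A :|: (B :\: A) = B.
Proof. by move=> /setIidPr AB; rewrite -{1}AB setID. Qed.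

Lemma cherryS e D D' : D \subset D' -> cherry e D -> cherry e D'.
Proof.
move=> /subsetP sDD' [x [y [z [/sDD' ? /sDD' ? /sDD' ? ?]]]].
by exists x, y, z.
Qed.

Lemma squareS e D D' : D \subset D' -> square e D -> square e D'.
Proof.
move=> /subsetP sDD' [x [y [z [t [/sDD' ? /sDD' ? /sDD' ? /sDD' ? ?]]]]].
by exists x, y, z, t.
Qed.

Lemma complete_toS c X Y X' Y' :
  X' \subset X -> Y' \subset Y -> complete_to c X Y -> complete_to c X' Y'.
Proof. by move=> /subsetP sX /subsetP sY cXY x y /sX xX /sY; apply: cXY. Qed.

Lemma complete_toC e c X Y :
  complementary e c -> complete_to c X Y -> complete_to c Y X.
Proof.
by move=> /complementaryC[c_sym _ _] cXY x y Yx Xy; rewrite c_sym; apply: cXY.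
Qed.

Lemma complete_to_disjoint e c X Y :
  complementary e c -> complete_to c X Y -> X :&: Y = set0.
Proof.
case=> _ _ cE cXY; apply/setP=> x; rewrite !inE; apply/negP=> /andP[xX xY].
by move: (cXY _ _ xX xY); rewrite cE eqxx.
Qed.

Lemma complete_to_ltn_card e c X Y : complementary e c -> complete_to c X Y ->
  X != set0 -> #|Y| < #|X :|: Y|.
Proof.
move=> eC cXY X0; rewrite cardsU (complete_to_disjoint eC cXY) cards0 subn0.
by rewrite -[ltnLHS]add0n ltn_add2r card_gt0.
Qed.

(** A finite search, so that case distinctions on cherries are constructive. *)
Lemma cherry_dec e D : cherry e D \/ ~ cherry e D.
Proof.
pose P := [exists x in D, exists y in D, exists z in D,
             [&& y != z, e x y & e x z]].
have: reflect (cherry e D) P.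
  apply: (iffP exists_inP) => [[x xD /exists_inP[y yD /exists_inP[z zD]]]|].
    by case/and3P=> *; exists x, y, z.
  case=> x [y [z [xD yD zD [yz xy xz]]]]; exists x => //.
  by apply/exists_inP; exists y => //; apply/exists_inP; exists z; rewrite ?yz ?xy.
by case=> ?; [left | right].
Qed.

(* A cherry is connected, so it lies on one side of a separation. *)
Lemma cherryU e c X Y : complementary e c -> complete_to c X Y ->
  cherry e (X :|: Y) -> cherry e X \/ cherry e Y.
Proof.
move=> eC cXY; have cYX := complete_toC eC cXY; case: eC => _ _ cE.
have no_edge x y : c x y -> e x y -> false.
  by rewrite cE => /andP[_ /negP].
have side (U V : {set T}) x y : complete_to c U V ->
    x \in U -> (y \in U) || (y \in V) -> e x y -> y \in U.
  by move=> cUV xU /orP[//|yV] /no_edge-/(_ (cUV _ _ xU yV)).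
case=> x [y [z []]]; rewrite !inE => /orP[xX|xY] yXY zXY [yz xy xz].
  by left; exists x, y, z; split=> //; apply: (side _ Y x).
right; exists x, y, z; rewrite orbC in yXY; rewrite orbC in zXY.
by split=> //; apply: (side _ X x).
Qed.

Lemma cherry_card e c D : complementary e c -> cherry e D -> 2 < #|D|.
Proof.
case=> _ e_irr _ [x [y [z [xD yD zD [yz xy xz]]]]].
have xNy : x != y by apply: contraTneq xy => ->; rewrite e_irr.
have xNz : x != z by apply: contraTneq xz => ->; rewrite e_irr.
apply/card_gt2P; exists x, y, z; split=> //; split=> //.
by rewrite eq_sym.
Qed.

(** The path on four vertices is self-complementary: if [x y z t] is an induced path for one
    relation, [y t x z] is one for the other. *)
Lemma p4_freeC e c : complementary e c -> p4_free e c -> p4_free c e.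
Proof.
move=> eC free x y z t [xy yz zt [xz yt xt]].
have [c_sym _ _] := complementaryC eC; have [e_sym _ _] := eC.
apply: (free y t x z); split; rewrite ?(e_sym t) //.
by split; rewrite // ?[c y x]c_sym ?[c t z]c_sym.
Qed.

(** * Disconnected graphs and complements: Seinsche's theorem *)

(** Unless [v] is adjacent to all of [S], let [C] be the component in [S] of a non-neighbour [z] of
    [v]. If [v] has no neighbour in [S :\: C], it joins the side [C]; if it has none in [C], it
    joins the side [S :\: C]. Otherwise a walk in [C] from [z] to a neighbour of [v] uses an edge
    between a non-neighbour and a neighbour of [v]; with [v] and a neighbour outside [C] it forms an
    induced path on four vertices. *)
Lemma separatedU1 e c v S : complementary e c -> p4_free e c -> v \notin S ->
  separated c S -> separated c (v |: S) \/ separated e (v |: S).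
Proof.
move=> eC free vS [X [Y [XYS X0 Y0 cXY]]].
have cYX := complete_toC eC cXY.
have [e_sym e_irr cE] := eC; have [c_sym _ _] := complementaryC eC.
have [vadj|] := boolP [forall x in S, e v x].
  right; exists [set v], S; split=> //.
  - by apply/set0Pn; exists v; rewrite inE.
  - by rewrite -XYS setU_eq0 negb_and X0.
  - by move=> u x /set1P-> xS; exact: (forall_inP vadj).
rewrite negb_forall => /existsP[z]; rewrite negb_imply => /andP[zS vNz].
pose r := [rel x y | [&& x \in S, y \in S & e x y]].
have r_sym : connect_sym r.
  by apply: sym_connect_sym => x y /=; rewrite e_sym andbCA.
pose C := [set y | connect r z y].
have Cstep x y : x \in C -> y \in S -> e x y -> y \in C.
  rewrite !inE => zx yS xy; apply: connect_trans (zx) _.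
  apply: connect1; rewrite /= yS xy !andbT.
  have cl : closed r (mem S) by move=> ? ? /and3P[/= -> ->].
  by rewrite -(closed_connect cl zx).
have CS : C \subset S.
  apply/subsetP=> x; rewrite inE => zx.
  have cl : closed r (mem S) by move=> ? ? /and3P[/= -> ->].
  by rewrite -(closed_connect cl zx).
have zC : z \in C by rewrite inE connect0.
(* [C] is not all of [S], because [r] never leaves the side of the given separation that contains
   [z]. *)
have [w wS wC] : exists2 w, w \in S & w \notin C.
  wlog zX : X Y XYS X0 Y0 cXY cYX / z \in X.
    move: (zS); rewrite -XYS inE => /orP[zX|zY] H.
      exact: (H X Y).
    by apply: (H Y X); rewrite // setUC.
  have [w wY] := set0Pn _ Y0; exists w; first by rewrite -XYS inE wY orbT.
  have cl : closed r (mem X).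
    apply: intro_closed => // x y /and3P[_ yS xy] xX.
    move: yS; rewrite -XYS inE => /orP[//|yY].
    by move: (cXY _ _ xX yY); rewrite cE xy andbF.
  rewrite inE; apply/negP => /(closed_connect cl); rewrite zX => /esym wX.
  by move: (cXY _ _ wX wY); rewrite cE eqxx.
have cC x y : x \in C -> y \in S -> y \notin C -> c x y.
  move=> xC yS yC; rewrite cE; apply/andP; split.
    by apply: contraNneq yC => <-.
  by apply: contra yC; apply: Cstep.
have vN x : x \in S -> v != x by apply: contraTneq => <-.
have [/exists_inP[x xS /andP[xC vx]]|vD] :=
    boolP [exists x in S, (x \notin C) && e v x]; last first.
  left; exists (v |: C), (S :\: C); split.
  - by rewrite -setUA setUDK.
  - by apply/set0Pn; exists v; rewrite setU11.
  - by apply/set0Pn; exists w; rewrite inE wC.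
  - move=> x y; rewrite in_setU1 in_setD => /predU1P[->|xC] /andP[yC yS].
      rewrite cE vN //=; apply: contra vD => vy.
      by apply/exists_inP; exists y; rewrite ?yC.
    exact: cC.
have [/exists_inP[y yC vy]|vC] := boolP [exists y in C, e v y]; last first.
  left; exists C, (v |: (S :\: C)); split.
  - by rewrite setUCA setUDK.
  - by apply/set0Pn; exists z.
  - by apply/set0Pn; exists v; rewrite setU11.
  - move=> x' y' x'C; rewrite in_setU1 in_setD => /predU1P[->|/andP[y'C y'S]].
      rewrite c_sym cE vN ?(subsetP CS) //=; apply: contra vC => vy.
      by apply/exists_inP; exists x'.
    exact: cC.
exfalso.
have [/exists_inP[y' y'C /exists_inP[z' z'C /and3P[vy' vNz' yz']]]|noyz] :=
    boolP [exists y' in C, exists z' in C, [&& e v y', ~~ e v z' & e y' z']].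
  apply: (free x v y' z'); split; rewrite // 1?e_sym //; split.
  - by rewrite c_sym cC.
  - by rewrite cE vN ?(subsetP CS).
  - by rewrite c_sym cC.
(* Without such an edge, the non-neighbours of [v] in [C] are closed under [r]. They include [z],
   hence also the neighbour [y] of [v], a contradiction. *)
have cl : closed r [pred u | ~~ e v u && (u \in C)].
  apply: intro_closed => // z' y' /and3P[/= _ y'S zy'] /andP[vNz' z'C].
  have y'C : y' \in C by apply: Cstep y'S zy'.
  apply/andP; split=> //; apply: contra noyz => vy'.
  apply/exists_inP; exists y' => //; apply/exists_inP; exists z' => //.
  by rewrite vy' vNz' e_sym.
have := yC; rewrite inE => /(closed_connect cl).
by rewrite !inE vNz connect0 vy.
Qed.

(* Seinsche's theorem *)
Lemma p4_free_separated e c S : complementary e c -> p4_free e c ->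
  1 < #|S| -> separated c S \/ separated e S.
Proof.
move=> eC free.
have [n] := ubnP #|S|; elim: n S => // n IHn S /ltnSE-leSn S_gt1.
have [v vS] : exists v, v \in S by apply/set0Pn; rewrite -card_gt0 ltnW.
have vS' : v \notin S :\ v by rewrite !inE eqxx.
move: S_gt1; rewrite -(setD1K vS) cardsU1 vS' ltnS leq_eqVlt.
case/predU1P=> [/esym/eqP/cards1P[w wE]|S'_gt1].
  have vw : v != w.
    by apply: contraNneq vS' => vw; rewrite wE inE vw.
  have [|vNw] := boolP (e v w); [right | left]; exists [set v], [set w].
    split; rewrite ?wE //; try by rewrite -card_gt0 cards1.
    by move=> x y /set1P-> /set1P->.
  split; rewrite ?wE //; try by rewrite -card_gt0 cards1.
  by case: eC => _ _ cE x y /set1P-> /set1P->; rewrite cE vw.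
have leS'n : #|S :\ v| < n.
  by move: leSn; rewrite (cardsD1 v) vS.
case: (IHn _ leS'n S'_gt1) => sep.
  exact: separatedU1 eC _ _ _.
(* A separation of the complement is extended with the two relations exchanged. *)
case: (separatedU1 (complementaryC eC) (p4_freeC eC free) vS' sep); by [right|left].
Qed.

(** * One vertex that meets all cherries *)

(* In the join of X and Y, any two pairs of vertices span a square, and so do
   a vertex and a cherry. *)
Lemma square_join e c X Y : complementary e c -> complete_to e X Y ->
  1 < #|X| -> 1 < #|Y| -> square e (X :|: Y).
Proof.
move=> [e_sym _ _] eXY /card_gt1P[x [x' [xX x'X xx']]].
move=> /card_gt1P[y [y' [yY y'Y yy']]].
exists x, y, x', y'; split; rewrite ?inE ?xX ?x'X ?yY ?y'Y ?orbT //.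
by split=> //; split; rewrite ?(e_sym y) ?(e_sym y') eXY.
Qed.

Lemma square_cone e c u Y : complementary e c -> complete_to e [set u] Y ->
  cherry e Y -> square e (u |: Y).
Proof.
move=> [e_sym e_irr _] euY [x [y [z [xY yY zY [yz xy xz]]]]].
have ue w : w \in Y -> e u w by move=> wY; apply: euY; rewrite ?inE.
exists u, y, x, z; split; rewrite ?inE ?eqxx ?xY ?yY ?zY ?orbT //.
split=> //; last by split; rewrite ?ue // e_sym // ue.
by apply: contraTneq (ue x xY) => ->; rewrite e_irr.
Qed.

(** By induction on [X], which is a join or a disjoint union. The absence of squares forces one side
    of a join to be a single vertex, and this vertex meets all cherries. In a disjoint union only
    one side can have cherries, and the induction applies to it. *)
Lemma cherry_transversal e c X : complementary e c -> p4_free e c ->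
    ~ square e X ->
    (forall D1 D2, D1 \subset X -> D2 \subset X -> cherry e D1 -> cherry e D2 ->
       ~ complete_to c D1 D2) ->
  exists2 A : {set T}, A \subset X & #|A| <= 1 /\ ~ cherry e (X :\: A).
Proof.
move=> eC free; have [n] := ubnP #|X|; elim: n X => // n IHn X /ltnSE-leXn.
move=> noSq noCC.
have [X_le1|X_gt1] := leqP #|X| 1.
  exists set0; rewrite ?sub0set // cards0 setD0; split=> //.
  by move/(cherry_card eC); rewrite ltnNge (leq_trans X_le1).
case: (p4_free_separated eC free X_gt1) => -[Y [Z [XE Y0 Z0 YZ]]]; last first.
  (* The join case: two vertices on each side would span a square. *)
  wlog: Y Z XE Y0 Z0 YZ / #|Y| <= 1.
    move=> H; have [Y_le1|Y_gt1] := leqP #|Y| 1; first exact: (H Y Z).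
    have [Z_le1|Z_gt1] := leqP #|Z| 1.
      by apply: (H Z Y); rewrite 1?setUC //; exact: complete_toC (complementaryC eC) YZ.
    by case: noSq; rewrite -XE; exact: square_join eC YZ _ _.
  move=> Y_le1; exists Y; first by rewrite -XE subsetUl.
  split=> // ch; apply: noSq; rewrite -XE.
  (* A cherry that avoids the single vertex [u] of [Y] lies in [Z] and spans a square with [u]. *)
  have /cards1P[u uE] : #|Y| == 1 by rewrite eqn_leq Y_le1 card_gt0.
  rewrite uE in YZ *; apply: square_cone eC YZ _.
  by apply: cherryS ch; rewrite -XE uE setDUl setDv set0U subsetDl.
(* The disjoint union case: cherries on both sides would be non-adjacent. *)
wlog noY : Y Z XE Y0 Z0 YZ / ~ cherry e Y.
  move=> H; have [chY|noY] := cherry_dec e Y; last exact: (H Y Z).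
  have [chZ|noZ] := cherry_dec e Z.
    by case: (noCC Y Z); rewrite // -XE ?subsetUl ?subsetUr.
  by apply: (H Z Y); rewrite 1?setUC //; exact: complete_toC eC YZ.
have ZX : Z \subset X by rewrite -XE subsetUr.
have ltZ : #|Z| < n.
  by apply: leq_trans leXn; rewrite -XE (complete_to_ltn_card eC).
have [||A AZ [A1 noA]] := IHn Z ltZ.
- by apply: contra_not noSq; apply: squareS.
- move=> D1 D2 D1Z D2Z; apply: noCC; exact: subset_trans ZX.
exists A; first exact: subset_trans ZX.
split=> //; rewrite -XE setDUl.
have YZA := complete_toS (subsetDl Y A) (subsetDl Z A) YZ.
case/(cherryU eC YZA) => //.
by move/(cherryS (subsetDl _ _)).
Qed.

(** * Unobstructed graphs without induced paths on four vertices can be split *)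

Lemma split_setC e c S : split_set e c S -> split_set c e S.
Proof. by case=> A [B [? ? ? ?]]; exists B, A; rewrite setUC setIC. Qed.

Lemma split_separated e c S : complementary e c -> p4_free e c ->
    ~ obstructed e c -> separated c S ->
    (forall S', #|S'| < #|S| -> split_set e c S') -> split_set e c S.
Proof.
move=> eC free unobs [X [Y [XYS X0 Y0 cXY]]] IH.
have cYX := complete_toC eC cXY.
(* The induction hypothesis splits [V], and [U] is added to the [B]-part, where a cherry would lie
   either in [U] or in [B]. *)
have one_side (U V : {set T}) : U :|: V = S -> U != set0 -> complete_to c U V ->
    ~ cherry e U -> split_set e c S.
  move=> UVS U0 cUV noU; have [|A [B [ABV AB0 noA noB]]] := IH V.
    by rewrite -UVS (complete_to_ltn_card eC).
  exists A, (U :|: B); split=> //.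
  - by rewrite setUCA ABV.
  - rewrite setIUr AB0 setU0 setIC.
    apply: complete_to_disjoint eC _; apply: complete_toS cUV => //.
    by rewrite -ABV subsetUl.
  have cUB : complete_to c U B.
    by apply: complete_toS cUV; rewrite // -ABV subsetUr.
  by case/(cherryU eC cUB).
have [chX|] := cherry_dec e X; last exact: one_side X0 cXY.
have [chY|] := cherry_dec e Y; last by apply: one_side Y0 cYX; rewrite setUC.
(* A square, or two non-adjacent cherries, in [U] would form an obstruction together with the cherry
   in [V]. *)
have transversal (U V : {set T}) : complete_to c U V -> cherry e V ->
    exists2 A : {set T}, A \subset U & #|A| <= 1 /\ ~ cherry e (U :\: A).
  move=> cUV chV; apply: (cherry_transversal eC free).
    by move=> sqU; apply: unobs; right; exists U, V.
  move=> D1 D2 D1U D2U ch1 ch2 cD; apply: unobs; left; exists D1, D2, V.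
  by split=> //; split=> //; apply: complete_toS cUV.
have [A AX [A_le1 noX]] := transversal X Y cXY chY.
have [B BY [B_le1 noY]] := transversal Y X cYX chX.
exists (A :|: B), (S :\: (A :|: B)); split.
- by rewrite setUDK // -XYS; apply: setUSS.
- by rewrite setIDA setIC -setIDA setDv setI0.
(* [A :|: B] has at most two vertices, too few for a cherry of [c]. *)
- move/(cherry_card (complementaryC eC)); apply/negP; rewrite -leqNgt.
  by apply: leq_trans (leq_card_setU _ _) _; apply: (leq_add A_le1).
have cXY' := complete_toS (subsetDl X A) (subsetDl Y B) cXY.
move=> ch; case: (cherryU eC cXY') => //; apply: cherryS ch.
rewrite -XYS; apply/subsetP=> x; rewrite !inE negb_or.
by case/andP=> /andP[-> ->].
Qed.

Lemma p4_free_split e c S : complementary e c -> p4_free e c ->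
  ~ obstructed e c -> ~ obstructed c e -> split_set e c S.
Proof.
move=> eC free un_e un_c.
have [n] := ubnP #|S|; elim: n S => // n IHn S /ltnSE-leSn.
have IH S' : #|S'| < #|S| -> split_set e c S'.
  by move=> ltS'; apply: IHn; apply: leq_trans leSn.
have [S_le1|S_gt1] := leqP #|S| 1.
  exists S, set0; rewrite setU0 setI0; split=> //.
    by move/(cherry_card (complementaryC eC)); rewrite ltnNge (leq_trans S_le1).
  by move/(cherry_card eC); rewrite cards0.
case: (p4_free_separated eC free S_gt1) => sep; first exact: split_separated IH.
(* If the complement is disconnected on [S], the two relations are exchanged. *)
apply/split_setC/split_separated => //; first exact: complementaryC.
- exact: p4_freeC.
- by move=> S' /IH/split_setC.
Qed.

(** * Split graphs are unobstructed *)

(** As [B] has no cherry, [A] meets every cherry of [e]. Three mutually non-adjacent cherries thus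
    yield a cherry of [c] in [A]. Any three vertices of a square form a cherry, so [A] contains two
    vertices of the square; with a vertex [u] of [A] in the non-adjacent cherry as centre, they form
    a cherry of [c] in [A]. *)
Lemma split_unobstructed e c : complementary e c ->
  split_set e c [set: T] -> ~ obstructed e c.
Proof.
move=> eC [A [B [ABT _ noA noB]]].
have [c_sym _ _] := complementaryC eC.
have Bmem x : x \notin A -> x \in B.
  by move/negPf=> xA; move: (in_setT x); rewrite -ABT inE xA.
have hit x y z : y != z -> e x y -> e x z -> [|| x \in A, y \in A | z \in A].
  move=> yz xy xz; apply/negPn/negP; rewrite !negb_or => /and3P[xA yA zA].
  by apply: noB; exists x, y, z; split; rewrite ?Bmem.
have meet D : cherry e D -> exists2 x, x \in A & x \in D.
  case=> x [y [z [xD yD zD [yz xy xz]]]].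
  by case/or3P: (hit _ _ _ yz xy xz) => inA; [exists x | exists y | exists z].
have irr x : ~ c x x by rewrite (_ : c x x = false) //; case: (complementaryC eC).
case=> [[D1 [D2 [D3 [/meet[x xA x1] /meet[y yA y2] /meet[z zA z3]]]]]|].
  case=> c12 c13 c23; apply: noA; exists x, y, z; split=> //; split.
  - by apply/eqP=> yz; apply: (irr z); rewrite -{1}yz; apply: c23.
  - exact: c12.
  - exact: c13.
case=> D1 [D2 [[x [y [z [t [xD yD zD tD [xz yt [xy yz zt tx]]]]]]] /meet[u uA uD]]].
move=> cD; have [e_sym e_irr _] := eC.
have no_pair v w : v \in A -> w \in A -> v \in D1 -> w \in D1 -> v != w -> False.
  move=> vA wA vD wD vw; apply: noA; exists u, v, w; split=> //; split=> //.
    by rewrite c_sym cD.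
  by rewrite c_sym cD.
have neq v w : e v w -> v != w by apply: contraTneq => ->; rewrite e_irr.
(* The four cherries of the square, centred at [y], [z], [t] and [x] in turn. *)
have := hit y x z xz; rewrite (e_sym y x) => /(_ xy yz) h1.
have := hit z y t yt; rewrite (e_sym z y) => /(_ yz zt) h2.
have := hit t x z xz tx; rewrite (e_sym t z) => /(_ zt) h3.
have := hit x y t yt xy; rewrite (e_sym x t) => /(_ tx) h4.
have pxy := no_pair x y _ _ xD yD (neq _ _ xy).
have pyz := no_pair y z _ _ yD zD (neq _ _ yz).
have pzt := no_pair z t _ _ zD tD (neq _ _ zt).
have ptx := no_pair t x _ _ tD xD (neq _ _ tx).
have pxz := no_pair x z _ _ xD zD xz.
have pyt := no_pair y t _ _ yD tD yt.
(* If at most one of the four vertices is in [A], some cherry is missed; otherwise one of the six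
   pairs gives the contradiction. *)
move: h1 h2 h3 h4 pxy pyz pzt ptx pxz pyt.
case: (x \in A); case: (y \in A); case: (z \in A); case: (t \in A) => //=;
  by move=> _ _ _ _ p1 p2 p3 p4 p5 p6; solve
   [ exact: p1 | exact: p2 | exact: p3 | exact: p4 | exact: p5 | exact: p6].
Qed.

End Complementary.

(** * Induced subgraphs as embeddings *)

Lemma mono_complementary (T T' : finType) (e c : rel T) (e' c' : rel T')
    (f : T -> T') : complementary e c -> complementary e' c' -> injective f ->
  {mono f : x y / e x y >-> e' x y} -> {mono f : x y / c x y >-> c' x y}.
Proof.
by move=> [_ _ cE] [_ _ cE'] f_inj fE x y; rewrite cE cE' inj_eq // fE.
Qed.

Section Embeddings.
Implicit Types G H : sgraph.

(** An induced copy of [H] within [D]; the set [D] serves to locate the parts of a disjoint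
    union. *)
Definition contains G (D : {set G}) H := exists f : H -> G,
  [/\ injective f, {mono f : x y / edge x y} & forall x, f x \in D].

Lemma complementary_edge G : complementary (@edge G) (@compl_edge G).
Proof. by split; [exact: edge_sym | exact: edge_irrefl | ]. Qed.

Lemma induced_containsP G H :
  (exists S : {set G}, isomorphic (induced S) H) <-> contains [set: G] H.
Proof.
split=> [[S [f [g fK gK] f_mono]]|[f [f_inj f_mono _]]].
  exists (fun x => val (g x)); split=> [x y /val_inj/(can_inj gK)//|x y|x].
    by rewrite -{2}(gK x) -{2}(gK y) f_mono.
  by rewrite inE.
exists (f @: setT).
(* [f] onto its image is an injection between types of equal size, hence a bijection. *)
pose h x : induced (f @: setT) := exist _ (f x) (imset_f f (in_setT x)).
have h_inj : injective h by move=> x y [/f_inj].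
have [|g hK gK] := inj_card_bij h_inj.
  by rewrite card_sig /= card_imset // cardsT.
exists g; first by exists h.
by move=> x y; rewrite -f_mono -{2}(gK x) -{2}(gK y).
Qed.

Lemma contains_compl G H :
  contains [set: G] (compl H) <-> contains [set: compl G] H.
Proof.
split=> -[f [f_inj f_mono _]]; exists f; split=> // x y.
  exact: mono_complementary (complementaryC (complementary_edge H))
    (complementary_edge G) f_inj f_mono x y.
exact: mono_complementary (complementary_edge H)
  (complementaryC (complementary_edge G)) f_inj f_mono x y.
Qed.

Lemma contains_disjoint_union G (D : {set G}) H1 H2 :
  contains D (disjoint_union H1 H2) <->
  exists D1 D2 : {set G}, [/\ D1 :|: D2 \subset D, contains D1 H1, contains D2 H2
    & complete_to (@compl_edge G) D1 D2].
Proof.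
split=> [[f [f_inj f_mono fD]]|[D1 [D2 [sD [f [f_inj fE fD]] [g [g_inj gE gD]] cD]]]].
  exists [set f (inl x) | x in H1], [set f (inr x) | x in H2]; split.
  - by apply/subsetP=> u /setUP[] /imsetP[x _ ->].
  - exists (fun x => f (inl x)); split=> [x y /f_inj[]//|x y|x].
      by rewrite f_mono.
    exact: imset_f.
  - exists (fun x => f (inr x)); split=> [x y /f_inj[]//|x y|x].
      by rewrite f_mono.
    exact: imset_f.
  - by move=> _ _ /imsetP[x _ ->] /imsetP[y _ ->]; rewrite /compl_edge f_mono inj_eq.
(* Completeness yields both injectivity across the two parts and the absence of edges between
   them. *)
have cfg x y : f x != g y /\ edge (f x) (g y) = false.
  by have /andP[-> /negPf->] := cD _ _ (fD x) (gD y).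
exists (fun u => match u with inl x => f x | inr y => g y end); split.
- case=> x [] y.
  + by move/f_inj->.
  + by move=> fg; case: (cfg x y); rewrite fg eqxx.
  + by move=> fg; case: (cfg y x); rewrite fg eqxx.
  + by move/g_inj->.
- case=> x [] y; rewrite ?fE ?gE //.
  + by case: (cfg x y).
  + by rewrite edge_sym; case: (cfg y x).
- by case=> x; apply: (subsetP sD); rewrite inE ?fD ?gD ?orbT.
Qed.

Lemma contains_copies G (D : {set G}) H p :
  contains D (copies H p) <->
  exists E : 'I_p -> {set G}, (forall i, E i \subset D /\ contains (E i) H) /\
    (forall i j, i != j -> complete_to (@compl_edge G) (E i) (E j)).
Proof.
split=> [[f [f_inj f_mono fD]]|[E [EH cE]]].
  exists (fun i => [set f (i, x) | x in H]); split=> [i|i j ij u w].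
    split; first by apply/subsetP=> _ /imsetP[x _ ->].
    exists (fun x => f (i, x)); split=> [x y /f_inj[]//|x y|x].
      by rewrite f_mono /= /copies_edge eqxx.
    exact: imset_f.
  move=> /imsetP[x _ ->] /imsetP[y _ ->].
  by rewrite /compl_edge f_mono inj_eq // /= /copies_edge xpair_eqE (negPf ij).
(* A finite choice of one embedding for each copy. *)
have /fin_all_exists[f fP] : forall i, exists f : {ffun H -> G},
    [/\ injective f, {mono f : x y / edge x y} & forall x, f x \in E i].
  move=> i; have [_ [f [f_inj fE fD]]] := EH i; exists (finfun f).
  by split=> [x y|x y|x]; rewrite !ffunE //; apply: f_inj.
have cf i j x y : i != j -> compl_edge (f i x) (f j y).
  by move=> ij; apply: cE ij _ _ _ _; [case: (fP i) | case: (fP j)].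
exists (fun u => f u.1 u.2); split=> [[i x] [j y]|[i x] [j y]|[i x]] /=.
- have [<-|ij] := eqVneq i j; first by have [f_inj _ _] := fP i; move/f_inj->.
  by move=> fxy; have := cf _ _ x y ij; rewrite fxy /compl_edge eqxx.
- rewrite /copies_edge /=; have [<-|ij] := eqVneq i j; first by have [_ -> _] := fP i.
  by have /andP[_ /negPf] := cf _ _ x y ij.
- by have [_ _ /(_ x)] := fP i; apply: subsetP; case: (EH i).
Qed.

(** * Cherries and squares as named graphs *)

(** The tuple lists the images of the vertices; symmetry and irreflexivity reduce the check of edges
    to pairs [i < j]. *)
Lemma containsP n (e : rel 'I_n) e_sym e_irr G (D : {set G}) (s : n.-tuple G) :
  uniq s -> {subset s <= D} ->
  (forall i j : 'I_n, i < j -> edge (tnth s i) (tnth s j) = e i j) ->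
  contains D (@SGraph _ e e_sym e_irr).
Proof.
move=> s_uniq sD sE; exists (tnth s); split=> [i j|i j|i]; last 1 first.
- exact/sD/mem_tnth.
- exact/tuple_uniqP.
- rewrite /=; case: (ltngtP i j) => [/sE//|/sE ji|/val_inj->].
    by rewrite edge_sym ji e_sym.
  by rewrite edge_irrefl e_irr.
Qed.

Lemma contains_cherry G (D : {set G}) :
  cherry (@edge G) D <-> contains D (P_ 3) \/ contains D (K_ 3).
Proof.
split=> [[x [y [z [xD yD zD [yz xy xz]]]]]|].
  have neq u v : @edge G u v -> u != v.
    by apply: contraTneq => ->; rewrite edge_irrefl.
  (* The centre [x] takes the middle place, as in [P_ 3]; the copy is a triangle exactly when [y]
     and [z] are adjacent. *)
  have s_uniq : uniq [tuple y; x; z].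
    by rewrite /= !inE negb_or yz (neq _ _ xz) eq_sym (neq _ _ xy).
  have sD : {subset [tuple y; x; z] <= D}.
    by apply/allP; rewrite /= xD yD zD.
  have [Eyz|Nyz] := boolP (edge y z); [right | left]; apply: containsP s_uniq sD _.
    case=> -[|[|[]]] //= ? [[|[|[]]]] //= ? _; rewrite !(tnth_nth x) //=.
    by rewrite edge_sym.
  case=> -[|[|[]]] //= ? [[|[|[]]]] //= ? _; rewrite !(tnth_nth x) //=.
    by rewrite edge_sym.
  exact: negPf.
pose o k : 'I_3 := inord k; have oE k : k < 3 -> o k = k :> nat by exact: inordK.
by case=> -[f [f_inj fE fD]]; exists (f (o 1)), (f (o 0)), (f (o 2)); split=> //;
  rewrite (inj_eq f_inj) !fE -val_eqE /= /path_edge /complete_edge -?val_eqE /= !oE.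
Qed.

(** The deleted edge joins [0] and [1], the only vertices below 2. *)
Lemma diamond_edge (x y : diamond) :
  edge x y = (x != y) && ~~ ((x < 2) && (y < 2)).
Proof.
rewrite /= /delete_edge_rel /= /complete_edge.
case: (eqVneq x y) => //= xy.
congr (~~ _); apply/eqP/andP.
  move=> /setP E; split.
    by move: (E x); rewrite !inE eqxx /= => /esym/orP[]/eqP->; rewrite inordK.
  by move: (E y); rewrite !inE eqxx orbT /= => /esym/orP[]/eqP->; rewrite inordK.
case=> x2 y2; apply/setP=> z; rewrite !inE -!val_eqE /= !inordK //.
move: xy x2 y2; rewrite -val_eqE /=.
by case: (val x) => [|[|]] //; case: (val y) => [|[|]] //; rewrite orbC.
Qed.

Lemma contains_square G (D : {set G}) : square (@edge G) D <->
  [\/ contains D (C_ 4), contains D diamond | contains D (K_ 4)].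
Proof.
split=> [[x [y [z [t [xD yD zD tD [xz yt [xy yz zt tx]]]]]]]|].
  have neq u v : @edge G u v -> u != v.
    by apply: contraTneq => ->; rewrite edge_irrefl.
  have s_uniq : uniq [tuple x; y; z; t].
    rewrite /= !inE !negb_or xz yt (neq _ _ xy) (neq _ _ yz) (neq _ _ zt).
    by rewrite eq_sym (neq _ _ tx).
  have sD : {subset [tuple x; y; z; t] <= D}.
    by apply/allP; rewrite /= xD yD zD tD.
  (* The diagonals [x z] and [y t] decide between [K_ 4], [diamond] and [C_ 4]. For the diamond, the
     ends of the missing diagonal come first, in the places of [0] and [1]. *)
  have s_uniq' : uniq [tuple x; z; y; t].
    rewrite -(perm_uniq (s1 := [:: x; y; z; t])) //.
    by rewrite (perm_cons x) (perm_catCA [:: y] [:: z]).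
  have s_uniq'' : uniq [tuple y; t; x; z].
    by rewrite -(perm_uniq (s1 := [:: x; z; y; t])) // (perm_catC [:: x; z] [:: y; t]).
  have sD' : {subset [tuple x; z; y; t] <= D}.
    by apply/allP; rewrite /= xD yD zD tD.
  have sD'' : {subset [tuple y; t; x; z] <= D}.
    by apply/allP; rewrite /= xD yD zD tD.
  have [yx zy tz xt] : [/\ edge y x, edge z y, edge t z & edge x t].
    by split; rewrite edge_sym.
  have [Exz|Nxz] := boolP (edge x z); have [Eyt|Nyt] := boolP (edge y t).
  - constructor 3; apply: containsP s_uniq sD _.
    by case=> -[|[|[|[]]]] //= ? [[|[|[|[]]]]] //= ? _; rewrite !(tnth_nth x).
  - constructor 2; apply: containsP s_uniq'' sD'' _ => i j.
    rewrite -[delete_edge_rel _ _ _ _]/(@edge diamond i j) diamond_edge.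
    case: i j => -[|[|[|[]]]] //= ? [[|[|[|[]]]]] //= ? _; rewrite !(tnth_nth x) //=.
    exact: negPf.
  - constructor 2; apply: containsP s_uniq' sD' _ => i j.
    rewrite -[delete_edge_rel _ _ _ _]/(@edge diamond i j) diamond_edge.
    case: i j => -[|[|[|[]]]] //= ? [[|[|[|[]]]]] //= ? _; rewrite !(tnth_nth x) //=.
    exact: negPf.
  - constructor 1; apply: containsP s_uniq sD _.
    by case=> -[|[|[|[]]]] //= ? [[|[|[|[]]]]] //= ? _; rewrite !(tnth_nth x) //=;
      rewrite /cycle_edge -!val_eqE //=; exact: negPf.
pose o k : 'I_4 := inord k; have oE k : k < 4 -> o k = k :> nat by exact: inordK.
case=> -[f [f_inj fE fD]].
- exists (f (o 0)), (f (o 1)), (f (o 2)), (f (o 3)); split=> //.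
  by rewrite !(inj_eq f_inj) !fE /= /cycle_edge -!val_eqE /= !oE.
(* The non-adjacent vertices [0] and [1] are opposite in the square. *)
- exists (f (o 0 : diamond)), (f (o 2 : diamond)).
  exists (f (o 1 : diamond)), (f (o 3 : diamond)); split=> //.
  by rewrite !(inj_eq f_inj) !fE !diamond_edge -!val_eqE /= !oE.
- exists (f (o 0)), (f (o 1)), (f (o 2)), (f (o 3)); split=> //.
  by rewrite !(inj_eq f_inj) !fE /= /complete_edge -!val_eqE /= !oE.
Qed.

(** * Obstructions as induced members of [F_cog_base] *)

Lemma contains_copies2 G (D1 D2 : {set G}) H :
  contains D1 H -> contains D2 H -> complete_to (@compl_edge G) D1 D2 ->
  contains (D1 :|: D2) (copies H 2).
Proof.
move=> H1 H2 c12; apply/contains_copies.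
have c21 := complete_toC (complementary_edge G) c12.
exists (fun i => if i == ord0 then D1 else D2); split.
  by move=> i; case: ifP; rewrite ?subsetUl ?subsetUr.
by case=> -[|[]] //= ? [[|[]]].
Qed.

Lemma complete_toU (T : finType) (c : rel T) (X Y Z : {set T}) :
  complete_to c X Z -> complete_to c Y Z -> complete_to c (X :|: Y) Z.
Proof. by move=> cX cY x z /setUP[/cX|/cY] h /h. Qed.

(** The number of triangles among three cherries selects one of the four cherry graphs; the type of
    the square and that of the cherry select one of the other six. *)
Lemma obstructed_base G : obstructed (@edge G) (@compl_edge G) <->
  exists2 H, F_cog_base H & contains [set: G] H.
Proof.
have cC := complementary_edge G.
have cherryJ (D : {set G}) J : J = P_ 3 \/ J = K_ 3 -> contains D J ->
  cherry (@edge G) D.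
  by move=> JE DJ; apply/contains_cherry; case: JE DJ => ->; [left | right].
split=> [[]|].
- move=> [D1 [D2 [D3 [/contains_cherry ch1 /contains_cherry ch2]]]].
  move=> /contains_cherry ch3 [c12 c13 c23].
  have copies3 J : contains D1 J -> contains D2 J -> contains D3 J ->
      contains [set: G] (copies J 3).
    move=> J1 J2 J3; apply/contains_copies.
    exists (tnth [tuple D1; D2; D3]); split=> [i|].
      by rewrite subsetT; split=> //; case: i => -[|[|[]]].
    have [c21 c31 c32] := And3 (complete_toC cC c12) (complete_toC cC c13)
      (complete_toC cC c23).
    by case=> -[|[|[]]] //= ? [[|[|[]]]].
  have union (E1 E2 : {set G}) J1 J2 : contains E1 J1 -> contains E2 J2 ->
      complete_to (@compl_edge G) E1 E2 -> contains [set: G] (disjoint_union J1 J2).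
    by move=> *; apply/contains_disjoint_union; exists E1, E2; rewrite subsetT.
  have two_one (E1 E2 E3 : {set G}) : contains E1 (P_ 3) -> contains E2 (P_ 3) ->
      contains E3 (K_ 3) -> complete_to (@compl_edge G) E1 E2 ->
      complete_to (@compl_edge G) E1 E3 -> complete_to (@compl_edge G) E2 E3 ->
      exists2 H, F_cog_base H & contains [set: G] H.
    move=> P1 P2 K3 e12 e13 e23; exists (disjoint_union (copies (P_ 3) 2) (K_ 3)).
      exact: F_2P3_K3.
    by apply: union (contains_copies2 P1 P2 e12) K3 _; apply: complete_toU.
  have one_two (E1 E2 E3 : {set G}) : contains E1 (K_ 3) -> contains E2 (K_ 3) ->
      contains E3 (P_ 3) -> complete_to (@compl_edge G) E1 E2 ->
      complete_to (@compl_edge G) E1 E3 -> complete_to (@compl_edge G) E2 E3 ->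
      exists2 H, F_cog_base H & contains [set: G] H.
    move=> K1 K2 P3 e12 e13 e23; exists (disjoint_union (P_ 3) (copies (K_ 3) 2)).
      exact: F_P3_2K3.
    apply: union P3 (contains_copies2 K1 K2 e12) _.
    by apply: complete_toC cC _; apply: complete_toU.
  have c32 := complete_toC cC c23; have c21 := complete_toC cC c12.
  (* In the mixed cases the sets are permuted so that the two cherries of the same type come
     first. *)
  case: ch1 ch2 ch3 => h1 [] h2 [] h3.
  + by exists (copies (P_ 3) 3); [exact: F_3P3 | exact: copies3].
  + exact: two_one h1 h2 h3 c12 c13 c23.
  + exact: two_one h1 h3 h2 c13 c12 c32.
  + exact: one_two h2 h3 h1 c23 c21 (complete_toC cC c13).
  + exact: two_one h2 h3 h1 c23 c21 (complete_toC cC c13).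
  + exact: one_two h1 h3 h2 c13 c12 c32.
  + exact: one_two h1 h2 h3 c12 c13 c23.
  + by exists (copies (K_ 3) 3); [exact: F_3K3 | exact: copies3].
- move=> [D1 [D2 [/contains_square sq /contains_cherry ch cD]]].
  have [J JE chJ] : exists2 J, J = P_ 3 \/ J = K_ 3 & contains D2 J.
    by case: ch => ?; [exists (P_ 3) | exists (K_ 3)]; auto.
  have union Q : contains D1 Q -> contains [set: G] (disjoint_union Q J).
    by move=> ?; apply/contains_disjoint_union; exists D1, D2; rewrite subsetT.
  case: sq => /union GQJ.
  + by exists (disjoint_union (C_ 4) J); first exact: F_C4_J.
  + by exists (disjoint_union diamond J); first exact: F_diamond_J.
  + by exists (disjoint_union (K_ 4) J); first exact: F_K4_J.
case=> H HF.
have three J : J = P_ 3 \/ J = K_ 3 -> contains [set: G] (copies J 3) ->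
    obstructed (@edge G) (@compl_edge G).
  move=> JE /contains_copies[D [DJ cD]]; left.
  have chD i : cherry (@edge G) (D i) by apply: cherryJ JE (proj2 (DJ i)).
  exists (D ord0), (D (inord 1)), (D (inord 2)); split=> //.
  by split; apply: cD; rewrite -val_eqE /= ?inordK.
have three' J J' (D D' : {set G}) : J = P_ 3 \/ J = K_ 3 -> J' = P_ 3 \/ J' = K_ 3 ->
    contains D (copies J 2) -> contains D' J' -> complete_to (@compl_edge G) D D' ->
    obstructed (@edge G) (@compl_edge G).
  move=> JE JE' /contains_copies[E [EJ cE]] D'J' cDD'; left.
  have chE i : cherry (@edge G) (E i) by apply: cherryJ JE (proj2 (EJ i)).
  exists (E ord0), (E ord_max), D'; split=> //.
    exact: cherryJ D'J'.
  split; first exact: cE.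
    by apply: complete_toS cDD' => //; case: (EJ ord0).
  by apply: complete_toS cDD' => //; case: (EJ ord_max).
have four (Q J : sgraph) : J = P_ 3 \/ J = K_ 3 ->
    (forall D : {set G}, contains D Q -> square (@edge G) D) ->
    contains [set: G] (disjoint_union Q J) -> obstructed (@edge G) (@compl_edge G).
  move=> JE QS /contains_disjoint_union[D1 [D2 [_ /QS ? /(cherryJ _ _ JE) ? ?]]].
  by right; exists D1, D2.
case: HF => [||||J JE|J JE|J JE].
- by apply: three; left.
- by move=> /contains_disjoint_union[D1 [D2 [_ h1 h2 c12]]];
    apply: three' h1 h2 c12; auto.
- by move=> /contains_disjoint_union[D1 [D2 [_ h1 h2 /(complete_toC cC) c12]]];
    apply: three' h2 h1 c12; auto.
- by apply: three; right.
- by apply: four JE _ => D DC; apply/contains_square; constructor 1.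
- by apply: four JE _ => D DC; apply/contains_square; constructor 2.
- by apply: four JE _ => D DC; apply/contains_square; constructor 3.
Qed.

(** * Degree conditions as absence of cherries *)

Lemma not_cherryP (T : finType) (e : rel T) (A : {set T}) :
  ~ cherry e A <-> {in A, forall x, #|[set y in A | e x y]| <= 1}.
Proof.
split=> [noA x xA|deg [x [y [z [xA yA zA [yz xy xz]]]]]].
  rewrite leqNgt; apply/negP=> /card_gt1P[y [z []]].
  rewrite !inE => /andP[yA xy] /andP[zA xz] yz.
  by apply: noA; exists x, y, z.
have := deg x xA; rewrite leqNgt => /negP[]; apply/card_gt1P.
by exists y, z; rewrite !inE yA zA xy xz.
Qed.

Lemma degree_induced G (A : {set G}) (x : induced A) :
  degree x = #|[set y in A | edge (val x) y]|.
Proof.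
rewrite /degree -(card_imset _ val_inj); congr #|pred_of_set _|.
apply/setP=> y; rewrite inE; apply/imsetP/andP=> [[z]|[yA xy]].
  by rewrite inE => xz ->; split=> //; exact: valP.
by exists (exist _ y yA); rewrite ?inE.
Qed.

(** A vertex of [A], its neighbours and its non-neighbours in [A] add up to [#|A|], so the degree
    bound leaves at most one non-neighbour. *)
Lemma min_degree_compl G (A : {set G}) :
  #|A| <= min_degree (induced A) + 2 <-> ~ cherry (@compl_edge G) A.
Proof.
have codeg x : x \in A -> (#|A| <= #|[set y in A | edge x y]| + 2) =
    (#|[set y in A | compl_edge x y]| <= 1).
  move=> xA; rewrite (cardsD1 x A) xA -(cardsID [set y | edge x y] (A :\ x)).
  have -> : (A :\ x) :&: [set y | edge x y] = [set y in A | edge x y].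
    apply/setP=> y; rewrite !inE; case: eqVneq => [->|] //=.
    by rewrite edge_irrefl andbF.
  have -> : (A :\ x) :\: [set y | edge x y] = [set y in A | compl_edge x y].
    by apply/setP=> y; rewrite !inE /compl_edge eq_sym andbC -andbA andbCA.
  by rewrite addnCA leq_add2l add1n ltnS.
rewrite not_cherryP; split=> [Adeg x xA|Acodeg].
  rewrite -codeg //; apply: leq_trans Adeg _; rewrite leq_add2r /min_degree.
  have := degree_induced (exist _ x xA : induced A) => /= <-.
  (* The minimum is at most the degree of [x], by induction on the list of vertices. *)
  elim: (index_enum _) (mem_index_enum (exist _ x xA : induced A)) => //= y r IHr.
  by rewrite inE big_cons geq_min => /predU1P[->|/IHr->]; rewrite ?leqnn ?orbT.
rewrite addnC -leq_subLR /min_degree.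
(* The default value of the minimum is [#|A|], which satisfies the bound; this also covers empty
   [A]. *)
apply: (big_ind (fun k => #|A| - 2 <= k)) => [|j k|x _].
- by rewrite card_sig leq_subr.
- by rewrite leq_min => -> ->.
- by rewrite leq_subLR addnC degree_induced codeg ?Acodeg //; exact: valP.
Qed.

Lemma max_degree_cherry G (B : {set G}) :
  max_degree (induced B) <= 1 <-> ~ cherry (@edge G) B.
Proof.
rewrite not_cherryP; split=> [/bigmax_leqP Bdeg x xB|Bdeg].
  by have := Bdeg (exist _ x xB : induced B) isT; rewrite degree_induced.
by apply/bigmax_leqP=> x _; rewrite degree_induced Bdeg //; exact: valP.
Qed.

(** * Translation of the theorem to split sets and obstructions *)

Lemma maya_tupi_split G :
  maya_tupi G <-> split_set (@edge G) (@compl_edge G) [set: G].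
Proof.
by split=> -[A [B [? ? /min_degree_compl ? /max_degree_cherry ?]]]; exists A, B.
Qed.

Lemma cograph_p4_free G : cograph G -> p4_free (@edge G) (@compl_edge G).
Proof.
move=> cogG x y z t [xy yz zt [xz yt xt]].
apply: (cogG _ erefl); apply/induced_containsP.
have neq u v : @edge G u v -> u != v.
  by apply: contraTneq => ->; rewrite edge_irrefl.
move: xz yt xt => /andP[xNz /negPf xz] /andP[yNt /negPf yt] /andP[xNt /negPf xt].
apply: (@containsP _ _ _ _ _ _ [tuple x; y; z; t]) => //.
- by rewrite /= !inE !negb_or xNz yNt xNt !neq.
- by move=> u _; rewrite inE.
- by case=> -[|[|[|[]]]] //= ? [[|[|[|[]]]]] //= ? _; rewrite !(tnth_nth x).
Qed.

(** The characterization of obstructions is applied to [compl G], whose non-adjacency is the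
    adjacency of [G]. *)
Lemma obstructed_compl G : obstructed (@compl_edge G) (@edge G) <->
  exists2 H, F_cog_base H & contains [set: G] (compl H).
Proof.
have [_ _ ccE] := complementaryC (complementary_edge G).
have cccE (X Y : {set G}) :
    complete_to (@edge G) X Y <-> complete_to (@compl_edge (compl G)) X Y.
  by split=> cXY x y xX yY; have := cXY x y xX yY; rewrite ccE.
have <- : (exists2 H, F_cog_base H & contains [set: compl G] H) <->
    (exists2 H, F_cog_base H & contains [set: G] (compl H)).
  by split=> -[H HF GH]; exists H => //; apply/contains_compl.
rewrite -obstructed_base; split=> -[].
- move=> [D1 [D2 [D3 [? ? ? [/cccE ? /cccE ? /cccE ?]]]]].
  by left; exists D1, D2, D3.
- by move=> [D1 [D2 [? ? /cccE ?]]]; right; exists D1, D2.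
- move=> [D1 [D2 [D3 [? ? ? [/cccE ? /cccE ? /cccE ?]]]]].
  by left; exists D1, D2, D3.
- by move=> [D1 [D2 [? ? /cccE ?]]]; right; exists D1, D2.
Qed.

Lemma is_free_unobstructed G : is_free F_cog G <->
  ~ obstructed (@edge G) (@compl_edge G) /\
  ~ obstructed (@compl_edge G) (@edge G).
Proof.
rewrite obstructed_base obstructed_compl.
split=> [Gfree|[noF noFc] _ [H HF|H HF] /induced_containsP GH].
- by split=> -[H HF /induced_containsP GH]; apply: Gfree GH; constructor.
- by apply: noF; exists H.
- by apply: noFc; exists H.
Qed.

End Embeddings.

Theorem corollary4p4 (G : sgraph) :
  cograph G -> (maya_tupi G <-> is_free F_cog G).
Proof.
move=> /cograph_p4_free free; have cG := complementary_edge G.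
rewrite maya_tupi_split is_free_unobstructed; split=> [Gs|[un_e un_c]].
  split; first exact: split_unobstructed.
  exact: split_unobstructed (complementaryC cG) (split_setC Gs).
exact: p4_free_split.
Qed.
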